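(* Let $q$ be a real number with $q\neq 0,\pm1$ and let $n$ be a positive integer. The $n$-th generalized Riemann difference ${_q}\bar\Delta_n(x,h;f)$ based at $x+h,x+qh,\ldots ,x+q^nh$ has the expression $${_q}\bar\Delta_n(x,h;f)=\bar\lambda_n\sum_{k=0}^n(-1)^kq^{\binom k2}\left[\begin{array}{c}n\\k\end{array}\right]_qf(x+q^{n-k}h),$$ where $\bar\lambda_n=n!/\left((q^n-1)(q^n-q)\cdots (q^n-q^{n-1})\right)$.
   Context: An $n$-th generalized Riemann difference is $\Delta_{\mathcal{A}}(x,h;f)=\sum_{k=0}^{\ell}A_kf(x+a_kh)$, where the real numbers $A_k$ are non-zero, the real numbers $a_k$ are distinct, and $\sum_{k=0}^{\ell}A_ka_k^j=\delta_{j,n}\cdot n!$ for $j=0,1,\ldots ,n$ (with $0^0=1$). The points $x+a_kh$ are its base points. When there are exactly $n+1$ base points, the $A_k$ are uniquely determined by the $a_k$. Quantum integers and Gaussian binomial coefficients: $[k]_q=1+q+\cdots +q^{k-1}$, $[k]_q!=[1]_q[2]_q\cdots [k]_q$ with $[0]_q!=1$, and $\left[\begin{array}{c}n\\k\end{array}\right]_q=\frac{[n]_q!}{[n-k]_q!\,[k]_q!}$ for $0\le k\le n$. *)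

(* Defs.v *)
From HB Require Import structures.
From mathcomp Require Import all_boot all_order all_algebra.
From mathcomp Require Import reals.

Set Implicit Arguments.
Unset Strict Implicit.
Unset Printing Implicit Defensive.

Import GRing.Theory Num.Theory.
Local Open Scope ring_scope.

Record riemann_difference (R : realType) (n : nat) := RiemannDifference {
  rd_last : nat;
  rd_coef : 'I_rd_last.+1 -> R;
  rd_node : 'I_rd_last.+1 -> R;
  rd_coef_neq0 : forall k, rd_coef k != 0;
  rd_node_inj : injective rd_node;
  rd_moment : forall j : nat, (j <= n)%N ->
    \sum_(k < rd_last.+1) rd_coef k * rd_node k ^+ j
      = (j == n)%:R * n`!%:R
}.

Arguments rd_last {R n} D : rename.
Arguments rd_coef {R n} D k : rename.
Arguments rd_node {R n} D k : rename.

Definition rd_eval (R : realType) (n : nat) (D : riemann_difference R n)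
    (x h : R) (f : R -> R) : R :=
  \sum_(k < (rd_last D).+1) rd_coef D k * f (x + rd_node D k * h).

(* The base points x + a_k h are compared through the a_k, as a set: for h = 0
   the points themselves all collapse to x. *)
Definition rd_based_at (R : realType) (n : nat) (D : riemann_difference R n)
    (s : seq R) : Prop :=
  codom (rd_node D) =i s.

Definition qint (R : realType) (q : R) (k : nat) : R := \sum_(i < k) q ^+ i.

Definition qfact (R : realType) (q : R) (k : nat) : R :=
  \prod_(1 <= i < k.+1) qint q i.

(* Only meaningful for k <= n. *)
Definition qbinom (R : realType) (q : R) (n k : nat) : R :=
  qfact q n / (qfact q (n - k) * qfact q k).

Definition lambda_bar (R : realType) (q : R) (n : nat) : R :=
  n`!%:R / \prod_(k < n) (q ^+ n - q ^+ k).

(* Main.v *)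
(** Put [B_k = lambda_bar * (-1)^k q^(k choose 2) [n, k]_q] and let [p] be the
    polynomial of degree at most [n] that agrees with [a |-> f (x + a h)] at
    [1, q, ..., q^n].  By the moment conditions every [n]-th Riemann difference
    based at these points returns [n!] times the coefficient of [X^n] in [p].  The
    [B_k] satisfy the moment conditions too, because Gauss's identity
    [sum_k (-1)^k q^(k choose 2) [n, k]_q X^(n-k) = (X-1)(X-q)...(X-q^(n-1))]
    vanishes at [X = q^j] for [j < n]. *)

Require Import Defs.
From HB Require Import structures.
From mathcomp Require Import all_boot all_order all_algebra.
From mathcomp Require Import reals ring.

Set Implicit Arguments.
Unset Strict Implicit.
Unset Printing Implicit Defensive.

Import GRing.Theory Num.Theory.
Local Open Scope ring_scope.

Lemma interpolation_exists (F : fieldType) (s : seq F) (g : F -> F) :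
  uniq s ->
  exists2 p : {poly F}, (size p <= size s)%N & {in s, forall a, p.[a] = g a}.
Proof.
elim: s => [|a s IHs] /=; first by exists 0; rewrite ?size_poly0.
case/andP=> anotin /IHs[p sz_p pE].
pose w : {poly F} := \prod_(b <- s) ('X - b%:P).
have wa : w.[a] != 0 by rewrite -[_ == 0]/(root w a) root_prod_XsubC.
(* Newton's correction: [w] vanishes at the earlier nodes, so adding a multiple of it changes
   nothing there, and the scalar is chosen to fix the value at [a]. *)
exists (p + ((g a - p.[a]) / w.[a]) *: w).
  apply: leq_trans (size_polyD _ _) _; rewrite geq_max (leq_trans sz_p) //=.
  by apply: leq_trans (size_scale_leq _ _) _; rewrite size_prod_XsubC.
move=> b; rewrite inE hornerD hornerZ => /predU1P[-> | bs].
  by rewrite divfK // addrC subrK.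
have /rootP-> : root w b by rewrite root_prod_XsubC.
by rewrite mulr0 addr0 pE.
Qed.

(** Both sides are linear in [p], and the moment conditions are the cases [p = X^j]. *)
Lemma moments_horner (F : fieldType) (n : nat) (c : F) (I : finType)
    (A a : I -> F) (p : {poly F}) :
  (forall j, (j <= n)%N -> \sum_k A k * a k ^+ j = (j == n)%:R * c) ->
  (size p <= n.+1)%N -> \sum_k A k * p.[a k] = p`_n * c.
Proof.
move=> mom sz_p.
under eq_bigr do rewrite (horner_coef_wide _ sz_p) mulr_sumr.
rewrite exchange_big /= big_ord_recr /= big1 ?add0r => [|j _].
  by under eq_bigr do rewrite mulrCA; rewrite -mulr_sumr mom // eqxx mul1r.
under eq_bigr do rewrite mulrCA.
by rewrite -mulr_sumr mom 1?ltnW // ltn_eqF // mul0r mulr0.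
Qed.

(** Since [q] is neither 1 nor -1, [|q|] is a positive real other than 1, whose powers are distinct.
    This yields both the distinctness of the nodes and the nonvanishing of all denominators. *)
Lemma expr_inj_neq_sign (R : realType) (q : R) :
  q != 0 -> q != 1 -> q != -1 -> injective (GRing.exp q).
Proof.
move=> q0 q1 qN1 i j eq_ij.
apply: (@ieexprIn _ `|q|); first by rewrite normr_gt0.
  by rewrite eqr_norml negb_and negb_or q1 qN1.
by rewrite -!normrX eq_ij.
Qed.

Section QBinomial.

Variables (R : realType) (q : R).
Hypotheses (q0 : q != 0) (q1 : q != 1) (qN1 : q != -1).

Lemma qintD m n : qint q (m + n) = qint q m + q ^+ m * qint q n.
Proof.
rewrite /qint big_split_ord /= mulr_sumr; congr (_ + _).
by apply: eq_bigr => i _; rewrite exprD.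
Qed.

Lemma qint_neq0 n : (0 < n)%N -> qint q n != 0.
Proof.
move=> n_gt0; apply/eqP => qn0.
have /eqP : q ^+ n - 1 = 0 by rewrite subrX1 -/(qint q n) qn0 mulr0.
rewrite subr_eq0 -(expr0 q) => /eqP/(expr_inj_neq_sign q0 q1 qN1) n0.
by rewrite n0 in n_gt0.
Qed.

Lemma qfactS n : qfact q n.+1 = qfact q n * qint q n.+1.
Proof. by rewrite /qfact big_nat_recr. Qed.

Lemma qfact_neq0 n : qfact q n != 0.
Proof.
elim: n => [|n IHn]; first by rewrite /qfact big_geq ?oner_neq0.
by rewrite qfactS mulf_neq0 ?qint_neq0.
Qed.

Lemma qbinom0 n : qbinom q n 0 = 1.
Proof.
by rewrite /qbinom subn0 {3}/qfact big_geq // mulr1 divff ?qfact_neq0.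
Qed.

Lemma qbinomnn n : qbinom q n n = 1.
Proof.
by rewrite /qbinom subnn {2}/qfact big_geq // mul1r divff ?qfact_neq0.
Qed.

Lemma qbinom_neq0 n k : qbinom q n k != 0.
Proof. by rewrite mulf_neq0 ?invr_neq0 ?mulf_neq0 ?qfact_neq0. Qed.

Lemma qbinomS n k : (k < n)%N ->
  qbinom q n.+1 k.+1 = qbinom q n k.+1 + q ^+ (n - k) * qbinom q n k.
Proof.
move=> lt_kn; rewrite /qbinom subSS.
have -> : (n - k = (n - k.+1).+1)%N by rewrite -subSn.
have nE : (n = (n - k.+1) + k.+1)%N by rewrite subnK.
set m := (n - k.+1)%N in nE *.
(* Here [m.+1] is [n - k]; this splitting of the top factor of [[n+1]_q!] produces the two terms of
   Pascal's rule. *)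
have eq_int : qint q n.+1 = qint q m.+1 + q ^+ m.+1 * qint q k.+1.
  by rewrite -qintD nE addSn.
rewrite !(qfactS n) eq_int !(qfactS m) !(qfactS k).
field.
by rewrite !qfact_neq0 !qint_neq0.
Qed.

(* The product on the right picks up [x - q^n] when passing to [n + 1]; this is
   why the form of Pascal's rule carrying [q^(n-k)] is used. *)
Lemma gauss_binomial (x : R) n :
  \sum_(k < n.+1) (-1) ^+ k * q ^+ 'C(k, 2) * qbinom q n k * x ^+ (n - k)
  = \prod_(k < n) (x - q ^+ k).
Proof.
elim: n => [|n IHn].
  by rewrite big_ord_recl !big_ord0 qbinom0 bin0n !expr0 !mulr1 addr0.
rewrite [RHS]big_ord_recr /= -IHn mulrBr.
(* The sum multiplied by [x] loses its first term and the one multiplied by [q^n] its last, so that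
   the remaining [n] terms pair up with a shift of one in the index. *)
rewrite [X in _ = X * x - _]big_ord_recl [X in _ = _ - X * q ^+ n]big_ord_recr /=.
rewrite [LHS]big_ord_recl [X in _ + X = _]big_ord_recr /=.
rewrite !qbinom0 !qbinomnn !subn0 !subnn /bump /=.
have split_term (i : 'I_n) :
  (-1) ^+ (1 + i) * q ^+ 'C(1 + i, 2) * qbinom q n.+1 (1 + i)
    * x ^+ (n.+1 - (1 + i)) =
  (-1) ^+ (1 + i) * q ^+ 'C(1 + i, 2) * qbinom q n (1 + i)
    * x ^+ (n - (1 + i)) * x
  - (-1) ^+ i * q ^+ 'C(i, 2) * qbinom q n i * x ^+ (n - i) * q ^+ n.
  (* As [C(i+1, 2) = C(i, 2) + i], the factor [q^(n-i)] from Pascal's rule completes [q^i] to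
     [q^n]. *)
  rewrite !add1n subSS qbinomS // exprS binS bin1 exprD.
  have -> : q ^+ n = q ^+ i * q ^+ (n - i) by rewrite -exprD subnKC // ltnW.
  have -> : x ^+ (n - i) = x * x ^+ (n - i.+1) by rewrite -exprS -subSn.
  ring.
under eq_bigr do rewrite split_term.
rewrite sumrB -!mulr_suml binS bin1 (exprD q 'C(n, 2) n) !exprS !expr0.
ring.
Qed.

Definition gauss_coef (n k : nat) : R :=
  lambda_bar q n * ((-1) ^+ k * q ^+ 'C(k, 2) * qbinom q n k).

Lemma prod_subX_neq0 n : \prod_(k < n) (q ^+ n - q ^+ k) != 0.
Proof.
apply/prodf_neq0 => k _; rewrite subr_eq0; apply/eqP.
by move=> /(expr_inj_neq_sign q0 q1 qN1) nk; have := ltn_ord k; rewrite -nk ltnn.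
Qed.

Lemma gauss_coef_neq0 n k : gauss_coef n k != 0.
Proof.
rewrite /gauss_coef mulf_neq0 //.
  by rewrite mulf_neq0 ?invr_neq0 ?prod_subX_neq0 // pnatr_eq0 -lt0n fact_gt0.
by rewrite mulf_neq0 ?qbinom_neq0 // mulf_neq0 ?signr_eq0 ?expf_neq0.
Qed.

Lemma gauss_node_inj n : injective (fun k : 'I_n.+1 => q ^+ (n - k)).
Proof.
move=> i j /= /(expr_inj_neq_sign q0 q1 qN1) eq_ij; apply/val_inj => /=.
by rewrite -(subKn (leq_ord i)) eq_ij subKn // leq_ord.
Qed.

Lemma gauss_moment n j : (j <= n)%N ->
  \sum_(k < n.+1) gauss_coef n k * (q ^+ (n - k)) ^+ j = (j == n)%:R * n`!%:R.
Proof.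
move=> le_jn.
(* Reading [(q^(n-k))^j] as [(q^j)^(n-k)] makes the sum an instance of Gauss's identity at
   [x = q^j]. *)
under eq_bigr do rewrite /gauss_coef -mulrA -exprM mulnC exprM.
rewrite -mulr_sumr gauss_binomial.
(* For [j = n] the product is the denominator of [lambda_bar]; for [j < n] its factor of index [j]
   is zero. *)
case: eqVneq => [-> | neq_jn].
  by rewrite mul1r /lambda_bar divfK ?prod_subX_neq0.
have lt_jn : (j < n)%N by rewrite ltn_neqAle neq_jn.
by rewrite (bigD1 (Ordinal lt_jn)) //= subrr mul0r mulr0 mul0r.
Qed.

Definition gauss_difference n : riemann_difference R n :=
  RiemannDifference (fun k => gauss_coef_neq0 n k) (@gauss_node_inj n)
    (@gauss_moment n).

Lemma gauss_difference_based_at n :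
  rd_based_at (gauss_difference n) [seq q ^+ k | k <- iota 0 n.+1].
Proof.
move=> a; apply/codomP/mapP => [[k ->] | [k]].
  by exists (n - k)%N; rewrite // mem_iota ltnS leq_subr.
rewrite mem_iota add0n ltnS => /= le_kn ->.
by exists (inord (n - k)); rewrite /= inordK ?ltnS ?leq_subr // subKn.
Qed.

End QBinomial.

(** Values are compared rather than coefficients, because [D] and [D'] may enumerate the nodes in
    different orders. Both values equal an expression in the interpolant alone. *)
Lemma rd_eval_unique (R : realType) (n : nat) (s : seq R)
    (D D' : riemann_difference R n) :
  uniq s -> (size s <= n.+1)%N -> rd_based_at D s -> rd_based_at D' s ->
  forall x h f, rd_eval D x h f = rd_eval D' x h f.
Proof.
move=> s_uniq sz_s Ds D's x h f.
have [p sz_p pE] := interpolation_exists (fun a => f (x + a * h)) s_uniq.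
have evalE (E : riemann_difference R n) :
    rd_based_at E s -> rd_eval E x h f = p`_n * n`!%:R.
  move=> Es; rewrite -(moments_horner (@rd_moment _ _ E) (leq_trans sz_p sz_s)).
  by apply: eq_bigr => k _; rewrite pE // -Es codom_f.
by rewrite !evalE.
Qed.

Theorem lemma1p2 (R : realType) (q : R) (n : nat)
    (hq0 : q != 0) (hq1 : q != 1) (hqN1 : q != -1) (hn : (0 < n)%N) :
  (exists D : riemann_difference R n,
     rd_based_at D [seq q ^+ k | k <- iota 0 n.+1]) /\
  (forall D : riemann_difference R n,
     rd_based_at D [seq q ^+ k | k <- iota 0 n.+1] ->
     forall (x h : R) (f : R -> R),
       rd_eval D x h f =
       lambda_bar q n *
         \sum_(k < n.+1)
           (-1) ^+ k * q ^+ 'C(k, 2) * qbinom q n k * f (x + q ^+ (n - k) * h)).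

Proof.
split.
  exists (gauss_difference hq0 hq1 hqN1 n); exact: gauss_difference_based_at.
move=> D Ds x h f.
have s_uniq : uniq [seq q ^+ k | k <- iota 0 n.+1].
  by rewrite (map_inj_uniq (expr_inj_neq_sign hq0 hq1 hqN1)) iota_uniq.
rewrite (rd_eval_unique s_uniq _ Ds (gauss_difference_based_at hq0 hq1 hqN1 n)).
  by rewrite mulr_sumr; apply: eq_bigr => k _; rewrite mulrA.
by rewrite size_map size_iota.
Qed.
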